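(* For all positive integers $n$ and non-negative integers $k$, $$\det_{0\le i,j\le n-1}\Big(\frac{2k+2}{i+j+k+1}\binom{2i+2j-1}{i+j+k}\Big)= \begin{cases} (-1)^{n_1\binom{k+1}2+1}(n_1-1), & n=(k+1)n_1,\\ (-1)^{n_1\binom{k+1}2+k+1}n_1, & n=(k+1)n_1+1,\\ 0, & n\not\equiv0,1\pmod{k+1}, \end{cases}$$ where the $(0,0)$-entry of the matrix is defined to be $0$, and $n_1$ is a non-negative integer (for $k=0$, the first case is meant).
   Context: Binomial coefficients $\binom ab$ with $a\ge0$ are $0$ if $b<0$ or $b>a$. *)

(* Defs.v *)
From HB Require Import structures.
From mathcomp Require Import all_boot all_order all_algebra.
Set Implicit Arguments. Unset Strict Implicit. Unset Printing Implicit Defensive.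
Import Order.TTheory GRing.Theory Num.Theory.
Local Open Scope ring_scope.

(* Entry (i,j) of the matrix: (2k+2)/(i+j+k+1) * C(2i+2j-1, i+j+k),
   with the (0,0)-entry defined to be 0 (there 2i+2j-1 = -1 < 0).
   For i+j >= 1, 2(i+j)-1 is a genuine natural number, so the nat
   binomial 'C agrees with the paper's convention. Computed in rat. *)
Definition entry19 (k i j : nat) : rat :=
  if (i + j == 0)%N then 0
  else ((2 * k + 2)%:R / (i + j + k + 1)%:R) * ('C((2 * (i + j)).-1, i + j + k))%:R.

Definition mat19 (n k : nat) : 'M[rat]_n :=
  \matrix_(i < n, j < n) entry19 k i j.

(* Right-hand side.  The case n = (k+1) n1 is tested first, so that for
   k = 0 the first case is used, as the paper specifies. *)
Definition rhs19 (n k : nat) : rat :=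
  let n1 := (n %/ k.+1)%N in
  if (n %% k.+1 == 0)%N then (-1) ^+ (n1 * 'C(k.+1, 2) + 1) * (n1%:R - 1)
  else if (n %% k.+1 == 1)%N then (-1) ^+ (n1 * 'C(k.+1, 2) + k + 1) * n1%:R
  else 0.

(* Main.v *)
Require Import Defs.
From HB Require Import structures.
From mathcomp Require Import all_boot all_order all_algebra.
From mathcomp Require Import ring zify.
Import Order.TTheory GRing.Theory Num.Theory.
Local Open Scope ring_scope.

(* Put K = k + 1 and x = z + 2 + 1/z.  The entry with i + j = m is a_m, the
   constant term of z^K (1 - z)/(1 + z) x^m, so the determinant is the Hankel
   determinant of the functional L : x^m |-> a_m on polynomials in x, and it
   does not change when x^i, x^j are replaced by any monic polynomials of
   degrees i, j.  Let Q_N = z^(KN) + z^(K(N-2)) + ... + z^(-KN), a monic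
   polynomial of degree KN in x.  By oddness in z, L(x Q_N p) vanishes for
   deg p < KN + K - 1 and is 1 for p monic of that degree.  Hence in the basis
   b_(KN+r) = Q_N x^r (r < K) the form L(x p q) is block diagonal with
   antitriangular K x K blocks.  Take the b_j as columns and 1, x b_0, x b_1, ...
   as rows: for n = KN + r with 1 <= r <= K, column KN has the single nonzero
   entry L(Q_N) = (-1)^(K(N+1)) N, in row 0, and expanding along it leaves
   N full blocks and an (r-1) x (r-1) corner, which is singular for 1 < r < K. *)

(** * Moment functionals and Hankel determinants *)

Definition moment {R : comNzRingType} (a : nat -> R) (p : {poly R}) : R :=
  \sum_(i < size p) p`_i * a i.

Lemma moment_widen (R : comNzRingType) (a : nat -> R) (p : {poly R}) n :
  (size p <= n)%N -> moment a p = \sum_(i < n) p`_i * a i.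
Proof.
move=> le_pn; rewrite /moment -!(big_mkord xpredT (fun i => p`_i * a i)).
rewrite (big_cat_nat (leq0n _) le_pn) /= [X in _ = _ + X]big_nat_cond.
rewrite [X in _ = _ + X]big1 ?addr0 // => i /andP[/andP[le_pi _] _].
by rewrite nth_default // mul0r.
Qed.

Lemma moment_is_linear {R : comNzRingType} (a : nat -> R) :
  scalar (moment a).
Proof.
move=> c p q; set n := maxn (size p) (size q).
have hp : (size p <= n)%N by rewrite leq_maxl.
have hq : (size q <= n)%N by rewrite leq_maxr.
have hs : (size (c *: p + q)%R <= n)%N.
  apply: leq_trans (size_polyD _ _) _; rewrite geq_max hq andbT.
  exact: leq_trans (size_scale_leq _ _) hp.
rewrite !(@moment_widen _ _ _ n) //= mulr_sumr -big_split.
by apply: eq_bigr => i _ /=; rewrite coefD coefZ mulrDl mulrA.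
Qed.

HB.instance Definition _ (R : comNzRingType) (a : nat -> R) :=
  GRing.isLinear.Build R {poly R} R *%R (moment a) (moment_is_linear a).

Lemma momentZ (R : comNzRingType) (a : nat -> R) c p :
  moment a (c *: p) = c * moment a p.
Proof. exact: linearZ. Qed.

Lemma momentB (R : comNzRingType) (a : nat -> R) p q :
  moment a (p - q) = moment a p - moment a q.
Proof. exact: linearB. Qed.

Lemma moment_sum (R : comNzRingType) (a : nat -> R) n (E : 'I_n -> {poly R}) :
  moment a (\sum_i E i) = \sum_i moment a (E i).
Proof. exact: linear_sum. Qed.

Lemma momentXn (R : comNzRingType) (a : nat -> R) m : moment a 'X^m = a m.
Proof.
rewrite (@moment_widen _ _ _ m.+1) ?size_polyXn // big_ord_recr /= big1 ?add0r.
  by rewrite coefXn eqxx mul1r.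
by move=> i _; rewrite coefXn ltn_eqF ?mul0r ?ltn_ord.
Qed.

Lemma det_coef_monic_basis (R : comNzRingType) n (c : nat -> {poly R}) :
  (forall i, c i \is monic) -> (forall i, size (c i) = i.+1) ->
  \det (\matrix_(i < n, j < n) (c i)`_j) = 1.
Proof.
move=> mc sc; rewrite det_trig.
  by rewrite big1 // => i _; rewrite mxE -(monicP (mc i)) lead_coefE sc.
apply/is_trig_mxP => i j ij; rewrite mxE nth_default // sc //.
Qed.

(** By bilinearity the new matrix is the Hankel matrix multiplied on the left and right by the
    coefficient matrices of [r] and [c], which are unitriangular. *)
Lemma det_hankel_basis (R : comNzRingType) n (a : nat -> R)
    (r c : nat -> {poly R}) :
  (forall i, r i \is monic) -> (forall i, size (r i) = i.+1) ->
  (forall i, c i \is monic) -> (forall i, size (c i) = i.+1) ->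
  \det (\matrix_(i < n, j < n) a (i + j)%N) =
  \det (\matrix_(i < n, j < n) moment a (r i * c j)).
Proof.
move=> mr sr mc sc.
pose A (b : nat -> {poly R}) := \matrix_(i < n, j < n) (b i)`_j.
suff -> : \matrix_(i < n, j < n) moment a (r i * c j) =
  A r *m (\matrix_(i < n, j < n) a (i + j)%N) *m (A c)^T.
  by rewrite !det_mulmx det_tr !det_coef_monic_basis // mul1r mulr1.
have expand (b : nat -> {poly R}) (i : 'I_n) : size (b i) = i.+1 ->
    b i = \sum_(l < n) (b i)`_l *: 'X^l.
  move=> sb; rewrite -poly_def; apply/polyP => l; rewrite coef_poly.
  by case: ltnP => // nl; rewrite nth_default // sb (leq_trans _ nl).
apply/matrixP => i j; rewrite !mxE.
have -> : r i * c j =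
    \sum_(m < n) \sum_(l < n) ((r i)`_l * (c j)`_m) *: 'X^(l + m).
  rewrite {1}(expand r) // {1}(expand c) // mulr_sumr; apply: eq_bigr => m _.
  rewrite mulr_suml; apply: eq_bigr => l _.
  by rewrite -scalerAl -scalerAr scalerA -exprD.
rewrite moment_sum; apply: eq_bigr => m _; rewrite !mxE moment_sum mulr_suml.
by apply: eq_bigr => l _; rewrite !mxE momentZ momentXn mulrAC.
Qed.

(** * Determinants of block triangular and antitriangular matrices *)

Lemma det_lblock_nat (R : comNzRingType) m n (G : nat -> nat -> R) :
  (forall i j, (i < m <= j)%N -> G i j = 0) ->
  \det (\matrix_(i < m + n, j < m + n) G i j) =
  \det (\matrix_(i < m, j < m) G i j) *
  \det (\matrix_(i < n, j < n) G (m + i)%N (m + j)%N).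
Proof.
move=> G0; rewrite -[X in \det X]submxK.
have -> : ursubmx (\matrix_(i < m + n, j < m + n) G i j) = 0.
  by apply/matrixP => i j; rewrite !mxE G0 //= ltn_ord leq_addr.
by rewrite det_lblock; congr (_ * _); congr (\det _); apply/matrixP => i j; rewrite !mxE.
Qed.

(** Row 0 has only its last entry, whose cofactor sign supplies the increment from ['C(n, 2)] to
    ['C(n.+1, 2)]. *)
Lemma det_antitriangular (R : comNzRingType) n (G : nat -> nat -> R) :
  (forall i j, (i + j + 1 < n)%N -> G i j = 0) ->
  (forall i j, (i + j + 1 = n)%N -> G i j = 1) ->
  \det (\matrix_(i < n, j < n) G i j) = (-1) ^+ 'C(n, 2).
Proof.
elim: n G => [|n IHn] G G0 G1; first by rewrite det_mx00.
rewrite (expand_det_row _ ord0) (bigD1 ord_max) //= big1 ?addr0.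
  rewrite mxE G1 ?mul1r; last by rewrite /= add0n addn1.
  rewrite /cofactor add0n /=.
  have -> : row' ord0 (col' ord_max (\matrix_(i < n.+1, j < n.+1) G i j)) =
     \matrix_(i < n, j < n) G i.+1 j.
    apply/matrixP => i j; rewrite !mxE /= /bump leq0n add1n.
    by rewrite leqNgt ltn_ord add0n.
  rewrite (IHn (fun i j => G i.+1 j)); first by rewrite -exprD binS bin1 addnC.
  - by move=> i j ij; apply: G0; lia.
  - by move=> i j ij; apply: G1; lia.
move=> j; rewrite -val_eqE /= => jn; rewrite mxE G0 ?mul0r //.
by have := ltn_ord j; rewrite /=; lia.
Qed.

(** * Ballot numbers and their moment functionals *)

Lemma moment_mulX (R : comNzRingType) (a : nat -> R) p :
  moment a ('X * p) = moment (fun m => a m.+1) p.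
Proof.
rewrite (@moment_widen _ _ _ (size p).+1); last first.
  by rewrite mulrC (leq_trans (size_polyMleq _ _)) // size_polyX addn2.
rewrite big_ord_recl coefXM mul0r add0r /moment.
by apply: eq_bigr => i _; rewrite coefXM.
Qed.

(* [ballot m J] is the odd part in J of the constant term of
   z^J (1 - z)/(1 + z) x^m; the even part is (-1)^J for m = 0 and vanishes
   for m > 0. *)
Fixpoint ballot (m J : nat) : rat :=
  if J is J'.+1 then
    if m is m'.+1 then ballot m' J.+1 + 2 * ballot m' J + ballot m' J'
    else (-1) ^+ J'
  else 0.

Arguments ballot : simpl never.

Lemma ballotS m J :
  ballot m.+1 J.+1 = ballot m J.+2 + 2 * ballot m J.+1 + ballot m J.
Proof. by []. Qed.

(** Pascal's rule applied twice gives the recurrence of [ballot]; at J = 0 the two binomials agree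
    by the symmetry of an odd row. *)
Lemma ballot_bin m J :
  ballot m.+1 J = 'C(m.*2.+1, m + J)%:R - 'C(m.*2.+1, (m + J).+1)%:R.
Proof.
elim: m J => [|m IHm] [|J].
- by rewrite /= subrr.
- by case: J => [|J]; rewrite /ballot //= !bin_small // !exprS; ring.
- rewrite [LHS]/ballot addn0 -(@bin_sub _ m.+1); last by lia.
  rewrite (_ : (_ - _)%N = m.+2) ?subrr //; lia.
rewrite ballotS !IHm !(addnS, addSn) doubleS !binS !natrD; ring.
Qed.

Lemma ballot_gt m J : (m.+1 < J)%N -> ballot m.+1 J = 0.
Proof. by move=> mJ; rewrite ballot_bin !bin_small ?subrr //; lia. Qed.

Lemma ballot_diag m : ballot m.+1 m.+1 = 1.
Proof.
by rewrite ballot_bin addnS addnn binn bin_small ?subr0.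
Qed.

Definition bmoment (J : nat) : {poly rat} -> rat := moment (ballot^~ J).

Lemma bmoment0 p : bmoment 0 p = 0.
Proof. by rewrite /bmoment /moment big1 // => -[[|i] ?] _; rewrite mulr0. Qed.

Lemma bmoment_mulX J p :
  bmoment J.+1 ('X * p) = bmoment J.+2 p + 2 * bmoment J.+1 p + bmoment J p.
Proof.
rewrite /bmoment moment_mulX /moment mulr_sumr -!big_split /=.
by apply: eq_bigr => i _; rewrite ballotS; ring.
Qed.

(** The factor ['X] removes the moment at m = 0, the only one that does not vanish for large J. *)
Lemma bmomentX_small J (p : {poly rat}) : (size p < J)%N -> bmoment J ('X * p) = 0.
Proof.
move=> pJ; rewrite /bmoment moment_mulX /moment big1 // => i _.
by rewrite ballot_gt ?mulr0 // (leq_ltn_trans _ pJ).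
Qed.

Lemma bmomentX_monic J (p : {poly rat}) :
  p \is monic -> size p = J -> bmoment J ('X * p) = 1.
Proof.
move=> mp sp; have := size_poly_gt0 p; rewrite monic_neq0 // sp.
case: J sp => // J sp _; rewrite /bmoment moment_mulX /moment sp big_ord_recr /=.
rewrite ballot_diag mulr1.
rewrite big1 ?add0r; first by rewrite -(monicP mp) lead_coefE sp.
by move=> i _; rewrite ballot_gt ?mulr0 // ltnS ltn_ord.
Qed.

(** * Lucas and Chebyshev polynomials acting on the functionals *)

(* [lucas j] is z^j + z^-j and [cheb K N] is z^(KN) + z^(K(N-2)) + ... + z^(-KN),
   expressed in 'X = z + 2 + 1/z. *)
Fixpoint lucas (j : nat) : {poly rat} :=
  if j is j'.+1 then
    if j' is j''.+1 then ('X - 2%:P) * lucas j' - lucas j'' else 'X - 2%:P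
  else 2%:P.

Fixpoint cheb (K N : nat) : {poly rat} :=
  if N is N'.+1 then
    if N' is N''.+1 then lucas K * cheb K N' - cheb K N'' else lucas K
  else 1.

Lemma monic_subl (p q : {poly rat}) : p \is monic -> (size q < size p)%N ->
  p - q \is monic /\ size (p - q) = size p.
Proof.
move=> mp qp; have sq : (size (- q)%R < size p)%N by rewrite size_polyN.
by rewrite monicE lead_coefDl // size_polyDl // -monicE.
Qed.

(** Indices start at 1 because [lucas 0] is the constant 2. *)
Lemma lucas_monic j : lucas j.+1 \is monic /\ size (lucas j.+1) = j.+2.
Proof.
elim/ltn_ind: j => -[_|j IH]; first by rewrite monicXsubC size_XsubC.
have [m1 s1] := IH j (ltnSn j).
have m2 : ('X - 2%:P) * lucas j.+1 \is monic by rewrite monicMl // monicXsubC.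
have s2 : size (('X - 2%:P) * lucas j.+1) = j.+3.
  by rewrite size_Mmonic ?monic_neq0 ?monicXsubC // size_XsubC s1.
rewrite -s2; apply: monic_subl m2 _; rewrite s2.
case: j IH {m1 s1 s2} => [|j] IH; first by rewrite size_polyC.
by have [_ ->] := IH j (ltnW (ltnSn _)).
Qed.

Lemma cheb_monic K N :
  cheb K.+1 N \is monic /\ size (cheb K.+1 N) = (K.+1 * N).+1.
Proof.
elim/ltn_ind: N => -[_|[_|N IH]].
- by rewrite monic1 size_poly1 muln0.
- by rewrite muln1; apply: lucas_monic.
have [m1 s1] := IH N.+1 (ltnSn _); have [_ s0] := IH N (ltnW (ltnSn _)).
have [ml sl] := lucas_monic K.
have m2 : lucas K.+1 * cheb K.+1 N.+1 \is monic by rewrite monicMl.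
have s2 : size (lucas K.+1 * cheb K.+1 N.+1) = (K.+1 * N.+2).+1.
  by rewrite size_Mmonic ?monic_neq0 // sl s1 !mulnS; lia.
rewrite -s2; apply: monic_subl m2 _; rewrite s2 s0 !mulnS; lia.
Qed.

Lemma lucas_horner0 j : (lucas j).[0] = 2 * (-1) ^+ j.
Proof.
elim/ltn_ind: j => -[_|[_|j IH]].
- by rewrite hornerE mulr1.
- by rewrite !hornerE; ring.
have -> : lucas j.+2 = ('X - 2%:P) * lucas j.+1 - lucas j by [].
by rewrite hornerD hornerN hornerM hornerXsubC !IH // !exprS; ring.
Qed.

(** At x = 0, that is z = -1, each of the N + 1 terms equals (-1)^(KN). *)
Lemma cheb_horner0 K N : (cheb K N).[0] = N.+1%:R * (-1) ^+ (K * N).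
Proof.
elim/ltn_ind: N => -[_|[_|N IH]].
- by rewrite hornerE muln0 mulr1.
- by rewrite /= lucas_horner0 muln1.
have -> : cheb K N.+2 = lucas K * cheb K N.+1 - cheb K N by [].
rewrite hornerD hornerN hornerM !IH // lucas_horner0 !mulnS !exprD.
have sK : (-1) ^+ K * (-1) ^+ K = 1 :> rat by rewrite -expr2 sqrr_sign.
set s := (-1) ^+ K in sK *; set t := (-1) ^+ _.
by rewrite (mulrA s s) sK mulrACA (mulrA s s) sK -!natr1; ring.
Qed.

(** Multiplication by z^j + z^-j shifts the index J by j both ways; the hypothesis keeps J - j an
    honest difference. *)
Lemma bmoment_lucas j J p : (j <= J)%N ->
  bmoment J (lucas j * p) = bmoment (J + j) p + bmoment (J - j) p.
Proof.
have X2 J' q : bmoment J'.+1 (('X - 2%:P) * q) = bmoment J'.+2 q + bmoment J' q.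
  by rewrite mulrBl mul_polyC /bmoment momentB momentZ -/(bmoment _ _)
    bmoment_mulX /bmoment; ring.
elim/ltn_ind: j p => -[_|[_|j IH]] p jJ.
- by rewrite mul_polyC addn0 subn0 /bmoment momentZ; ring.
- by case: J jJ => // J _; rewrite X2 addn1 subSS subn0.
have -> : lucas j.+2 * p = lucas j.+1 * (('X - 2%:P) * p) - lucas j * p.
  by rewrite mulrA [lucas _ * ('X - _)]mulrC -mulrBl.
rewrite /bmoment momentB -!/(bmoment _ _) !IH ?(ltnW jJ) //; last by lia.
have -> : (J + j.+1 = (J + j).+1)%N by lia.
have -> : (J - j.+1 = (J - j.+2).+1)%N by lia.
have -> : (J - j = (J - j.+2).+2)%N by lia.
by rewrite !X2 !addnS; ring.
Qed.

(** The factor [cheb K N] spreads the index K over K(N+1), K(N-1), ..., -K(N-1). By oddness in the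
    index all but the first cancel; the induction uses this as [bmoment 0 = 0]. *)
Lemma bmoment_cheb K N p :
  bmoment K (cheb K N * p) = bmoment (K * N.+1) p.
Proof.
elim/ltn_ind: N p => -[_|[_|N IH]] p.
- by rewrite mul1r muln1.
- by rewrite /= bmoment_lucas // subnn bmoment0 addr0 addnn muln2.
have -> : cheb K N.+2 * p = cheb K N.+1 * (lucas K * p) - cheb K N * p.
  by rewrite mulrA [cheb _ _ * lucas _]mulrC -mulrBl.
rewrite /bmoment momentB -!/(bmoment _ _) !IH //.
rewrite bmoment_lucas; last by rewrite leq_pmulr.
have -> : (K * N.+2 - K = K * N.+1)%N by rewrite mulnS addKn.
by rewrite addrK addnC -mulnS.
Qed.

(** * The matrix entries as moments *)

Lemma entry19_ballot k i j :
  entry19 k i j = ballot (i + j) k.+1 + (-1) ^+ k.+1 * (i + j == 0)%N%:R.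
Proof.
rewrite /entry19; case: (i + j)%N => [|m].
  by rewrite eqxx mulr1 /ballot exprS; ring.
rewrite ballot_bin mulr0 addr0 !mul2n doubleS addn1 addSn !addnS [LHS]/=.
(* The ratio of adjacent binomials, (m - k)/(m + k + 2), turns their difference into the factor (2k
   + 2)/(m + k + 2). For k > m the natural subtraction truncates, but all binomials vanish. *)
have h := mul_bin_left m.*2.+1 (m + k).+1.
have [km|mk] := leqP k m; last first.
  by rewrite !bin_small ?mulr0 ?subrr //; lia.
have {}h : (m + k).+2%:R * 'C(m.*2.+1, (m + k).+2)%:R =
   (m%:R - k%:R) * 'C(m.*2.+1, (m + k).+1)%:R :> rat.
  by rewrite -natrM h natrM -natrB //; congr (_%:R * _); lia.
have nz : (m + k).+2%:R != 0 :> rat by rewrite pnatr_eq0.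
apply: (mulfI nz); rewrite mulrBr h mulrA mulrCA mulfV // mulr1 -mulrBl.
by congr (_ * _); rewrite -!natr1 !natrD -!addnn !natrD; ring.
Qed.

(** The functional L: entries depend only on i + j, so column 0 lists all moments. *)
Definition amoment (k : nat) : {poly rat} -> rat :=
  moment (fun m => entry19 k m 0).

Lemma amoment_bmoment k p :
  amoment k p = bmoment k.+1 p + (-1) ^+ k.+1 * p.[0].
Proof.
rewrite /amoment /bmoment !(@moment_widen _ _ p (size p).+1) //.
rewrite !big_ord_recl horner_coef0 !entry19_ballot /= mulr1 mulrDr.
rewrite -!addrA; congr (_ + _); rewrite addrC mulrC; congr (_ + _).
apply: eq_bigr => i _; rewrite entry19_ballot /= addn0 mulr0 addr0.
by [].
Qed.

(** With the common sign (-1)^(K(N+1)), the even part contributes N + 1 through the value at x = 0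
    and the odd part contributes -1. *)
Lemma amoment_cheb k N :
  amoment k (cheb k.+1 N) = (-1) ^+ (k.+1 * N.+1) * N%:R.
Proof.
rewrite amoment_bmoment cheb_horner0 -[cheb _ _]mulr1 bmoment_cheb.
have -> : bmoment (k.+1 * N.+1) 1 = - (-1) ^+ (k.+1 * N.+1).
  by rewrite /bmoment -(expr0 'X) momentXn mulSn /ballot /= exprS mulN1r opprK.
by rewrite mulnS exprD -natr1; ring.
Qed.

(** * The adapted basis and its block structure *)

Definition qbasis (k j : nat) : {poly rat} :=
  cheb k.+1 (j %/ k.+1) * 'X^(j %% k.+1).

Lemma qbasis_monic k j : qbasis k j \is monic.
Proof. by rewrite monicMl ?monicXn //; have [] := cheb_monic k (j %/ k.+1). Qed.

Lemma size_qbasis k j : size (qbasis k j) = j.+1.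
Proof.
have [mc sc] := cheb_monic k (j %/ k.+1).
rewrite size_Mmonic ?monicXn ?monic_neq0 // sc size_polyXn addnS /=.
by rewrite addSn mulnC -divn_eq.
Qed.

Lemma qbasisE k N r : (r <= k)%N ->
  qbasis k (k.+1 * N + r) = cheb k.+1 N * 'X^r.
Proof.
move=> rk; rewrite /qbasis mulnC divnMDl // divn_small // addn0.
by rewrite modnMDl modn_small.
Qed.

Definition gram (k i j : nat) : rat := amoment k ('X * qbasis k i * qbasis k j).

Lemma gramC k i j : gram k i j = gram k j i.
Proof. by rewrite /gram mulrAC. Qed.

(** The factor ['X] kills the value at 0, so only the odd part of L remains. *)
Lemma amoment_mulX_cheb k N p :
  amoment k ('X * cheb k.+1 N * p) = bmoment (k.+1 * N.+1) ('X * p).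
Proof.
rewrite amoment_bmoment !hornerM hornerX !mul0r mulr0 addr0.
by rewrite mulrAC mulrC bmoment_cheb.
Qed.

Lemma gram_cheb k M N s r : (s <= k)%N -> (r <= k)%N ->
  gram k (k.+1 * N + s) (k.+1 * M + r) =
  bmoment (k.+1 * N.+1) ('X * (cheb k.+1 M * 'X^(s + r))).
Proof.
move=> sk rk; rewrite /gram !qbasisE // -amoment_mulX_cheb exprD; congr amoment.
by ring.
Qed.

Lemma size_chebXn k M r :
  size (cheb k.+1 M * 'X^r) = (k.+1 * M + r).+1.
Proof.
have [mc sc] := cheb_monic k M.
by rewrite size_Mmonic ?monicXn ?monic_neq0 // sc size_polyXn addnS /= addSn.
Qed.

(** Absorbing the [cheb] factor of the later block into the index leaves a polynomial of too small a
    degree, even when both remainders equal k. *)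
Lemma gram_lt k i j : (j %/ k.+1 < i %/ k.+1)%N -> gram k i j = 0.
Proof.
rewrite (divn_eq i k.+1) (divn_eq j k.+1).
have := ltn_pmod i (ltn0Sn k); have := ltn_pmod j (ltn0Sn k).
move: (i %/ _)%N (j %/ _)%N (i %% _)%N (j %% _)%N => N M s r rk sk.
rewrite !divnMDl // !divn_small // !addn0 => MN.
rewrite ![(_ * k.+1)%N]mulnC gram_cheb // bmomentX_small // size_chebXn.
by have := leq_mul (leqnn k.+1) MN; rewrite !mulnS; lia.
Qed.

Lemma gram_block_small k N s r :
  (s + r < k)%N -> gram k (k.+1 * N + s) (k.+1 * N + r) = 0.
Proof.
move=> srk; rewrite gram_cheb ?bmomentX_small ?size_chebXn ?mulnS //; lia.
Qed.

Lemma gram_block_diag k N s r :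
  (s + r)%N = k -> gram k (k.+1 * N + s) (k.+1 * N + r) = 1.
Proof.
move=> srk; rewrite gram_cheb ?bmomentX_monic ?size_chebXn ?mulnS //; try lia.
by rewrite monicMl ?monicXn //; have [] := cheb_monic k N.
Qed.

Lemma det_gram k N :
  \det (\matrix_(i < k.+1 * N, j < k.+1 * N) gram k i j) =
  (-1) ^+ (N * 'C(k.+1, 2)).
Proof.
elim: N => [|N IHN]; first by rewrite muln0 det_mx00.
rewrite mulnSr det_lblock_nat => [|i j /andP[iN jN]].
  rewrite IHN (@det_antitriangular _ _
    (fun i j => gram k (k.+1 * N + i) (k.+1 * N + j))).
  - by rewrite mulSnr exprD.
  - by move=> i j ij; rewrite gram_block_small //; lia.
  - by move=> i j ij; rewrite gram_block_diag //; lia.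
rewrite gramC gram_lt // ltn_divLR // mulnC (leq_trans iN) //.
by rewrite leq_mul2l /= leq_divRL // mulnC.
Qed.

(** * Reduction to a corner determinant and its evaluation *)

Definition lbasis (k i : nat) : {poly rat} :=
  if i is i'.+1 then 'X * qbasis k i' else 1.

Lemma lbasis_monic k i : lbasis k i \is monic.
Proof.
by case: i => [|i]; rewrite ?monic1 // monicMl ?monicX ?qbasis_monic.
Qed.

Lemma size_lbasis k i : size (lbasis k i) = i.+1.
Proof.
case: i => [|i]; first by rewrite size_poly1.
by rewrite size_Mmonic ?monicX ?qbasis_monic ?polyX_eq0 // size_polyX size_qbasis.
Qed.

(** Here r is one less than in the overview. Deleting row 0 and column KN shifts the later columns
    by one, hence [j.+1] in the corner. *)
Lemma det_mat19_gram k N r : (r <= k)%N ->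
  \det (mat19 (k.+1 * N + r).+1 k) =
  (-1) ^+ (k.+1 + N * 'C(k.+1, 2)) * N%:R *
  \det (\matrix_(i < r, j < r) gram k (k.+1 * N + i) (k.+1 * N + j.+1)).
Proof.
move=> rk; set n := (k.+1 * N + r).+1.
have -> : mat19 n k = \matrix_(i < n, j < n) entry19 k (i + j) 0.
  by apply/matrixP => i j; rewrite !mxE /entry19 addn0.
rewrite (det_hankel_basis _ _ (fun m => entry19 k m 0) _ _ (lbasis_monic k) (size_lbasis k)
  (qbasis_monic k) (size_qbasis k)).
have cn : (k.+1 * N < n)%N by rewrite ltnS leq_addr.
rewrite (expand_det_col _ (Ordinal cn)) (bigD1 ord0) //= big1 ?addr0; last first.
  case=> -[|i] ni // _; rewrite mxE.
  (* Rows of earlier blocks vanish by [gram_lt]; in the last block i - KN < r <= k, so the entry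
     lies above the antidiagonal. *)
  suff /= g0 : gram k i (k.+1 * N) = 0 by rewrite [moment _ _]g0 mul0r.
  have [iN|Ni] := ltnP i (k.+1 * N).
    by rewrite gramC gram_lt // mulKn // ltn_divLR // mulnC.
  rewrite -(subnKC Ni) -[X in gram _ _ X]addn0 gram_block_small //.
  by rewrite addn0; move: ni; rewrite ltnS; lia.
rewrite mxE mul1r -[X in moment _ (qbasis k X)]addn0 qbasisE // expr0 mulr1.
rewrite -/(amoment k _) amoment_cheb /cofactor add0n.
have -> : row' ord0 (col' (Ordinal cn)
    (\matrix_(i < n, j < n) moment (fun m => entry19 k m 0)
       (lbasis k i * qbasis k j))) =
  \matrix_(i < k.+1 * N + r, j < k.+1 * N + r) gram k i (bump (k.+1 * N) j).
  by apply/matrixP => i j; rewrite !mxE.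
rewrite (@det_lblock_nat _ _ _ (fun i j => gram k i (bump (k.+1 * N) j)));
  last first.
  move=> i j /andP[iN jN]; rewrite gramC gram_lt // ltn_divLR // mulnC.
  rewrite (leq_trans iN) // leq_mul2l /= leq_divRL // mulnC /bump jN.
  by rewrite (leq_trans jN) // leqnSn.
have -> : \matrix_(i < k.+1 * N, j < k.+1 * N) gram k i (bump (k.+1 * N) j) =
    \matrix_(i < k.+1 * N, j < k.+1 * N) gram k i j.
  by apply/matrixP => i j; rewrite !mxE /bump leqNgt ltn_ord.
rewrite det_gram.
have -> : \matrix_(i < r, j < r)
      gram k (k.+1 * N + i) (bump (k.+1 * N) (k.+1 * N + j)) =
    \matrix_(i < r, j < r) gram k (k.+1 * N + i) (k.+1 * N + j.+1).
  by apply/matrixP => i j; rewrite !mxE /bump leq_addr add1n addnS.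
rewrite -[nat_of_ord (Ordinal cn)]/(k.+1 * N)%N mulnS.
rewrite (exprD _ k.+1 (k.+1 * N)) (exprD _ k.+1 (N * _)).
(* The cofactor sign (-1)^(KN) cancels the same factor in L(Q_N). *)
have := sqrr_sign rat (k.+1 * N); rewrite expr2.
set s := (-1) ^+ (k.+1 * N) => s2; move: (\det _) => d.
by apply: etrans (mul1r _); rewrite -[X in _ = X * _]s2; ring.
Qed.

Theorem theorem19 (n k : nat) (hn : (0 < n)%N) :
  \det (mat19 n k) = rhs19 n k.
Proof.
case: n hn => // n _; rewrite (divn_eq n k.+1) mulnC.
have rk : (n %% k.+1 <= k)%N by rewrite -ltnS ltn_pmod.
move: (n %/ k.+1)%N (n %% k.+1)%N rk => N r rk.
rewrite det_mat19_gram // /rhs19.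
have [->|ltrk] := eqVneq r k.
  (* Now n = K(N + 1), so n1 - 1 = N. The shifted corner is k x k and again antitriangular, and
     ['C(k, 2) + k = 'C(k.+1, 2)] matches the signs. *)
  rewrite -addnS -mulnSr mulKn // modnMr eqxx.
  rewrite (@det_antitriangular _ _
    (fun i j => gram k (k.+1 * N + i) (k.+1 * N + j.+1))).
  - rewrite -natr1 addrK mulrAC -exprD; congr (_ * _).
    by congr (_ ^+ _); rewrite mulSnr binS bin1; lia.
  - by move=> i j ij; rewrite gram_block_small //; lia.
  - by move=> i j ij; rewrite gram_block_diag //; lia.
have {}rk : (r < k)%N by rewrite ltn_neqAle ltrk.
have -> : ((k.+1 * N + r).+1 %/ k.+1 = N)%N.
  by rewrite -addnS mulnC divnMDl // divn_small // addn0.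
have -> : ((k.+1 * N + r).+1 %% k.+1 = r.+1)%N.
  by rewrite -addnS mulnC modnMDl modn_small.
(* For r = 0 the corner is empty and n = KN + 1. Otherwise its first column vanishes, since i + 1 <
   k in every row. *)
case: r rk {ltrk} => [|r] rk /=.
  by rewrite det_mx00 mulr1 -addnA addn1 addnC.
rewrite (expand_det_col _ ord0) big1 ?mulr0 // => i _.
by rewrite mxE gram_block_small ?mul0r //= addn1 (leq_ltn_trans _ rk).
Qed.
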